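(* Let $I_0=\{0,1,2,\ldots\}$. Every infinitely divisible law on $I_0$ having integer-valued components (equivalently, whose probability generating function $Q$ can be written, for every integer $n\geq 1$, as $Q=\{Q_n\}^n$ with $Q_n$ a probability generating function) is a Poisson compound of non-negative integer-valued random variables. Conversely, every Poisson compound of non-negative integer-valued random variables is an infinitely divisible law on $I_0$ having integer-valued components.
   Context: A law (of a random variable $X$) is infinitely divisible if for every integer $n\geq 1$ there exist independent identically distributed random variables $X_{1n},\ldots,X_{nn}$, called the components, such that $X \overset{d}{=} X_{1n}+\cdots+X_{nn}$. An infinitely divisible law on $I_0$ has integer-valued components if, for every $n\geq 1$, these components take values (almost surely) in $I_0$. The probability generating function of a random variable $X$ on $I_0$ is $Q(s)=E(s^X)$. A Poisson compound of non-negative integer-valued random variables is the law of $Y_1+\cdots+Y_N$, where $N$ is Poisson with some parameter $\lambda>0$, the $Y_i$ are independent identically distributed random variables with values in $I_0$ (the value $0$ being allowed) and $N$ is independent of $(Y_i)$; equivalently its probability generating function is $\exp\{-\lambda(1-R(s))\}$, where $R$ is the probability generating function of a random variable on $I_0$. *)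

(* Defs.v *)
From HB Require Import structures.
From mathcomp Require Import all_boot all_order all_algebra.
From mathcomp Require Import all_classical all_reals all_analysis.

Set Implicit Arguments.
Unset Strict Implicit.
Unset Printing Implicit Defensive.

Import Order.TTheory GRing.Theory Num.Theory.
Import numFieldNormedType.Exports.

Local Open Scope classical_set_scope.
Local Open Scope ring_scope.

Definition mutually_independent (R : realType) d (T : measurableType d)
    (P : probability T R) d' (V : measurableType d') (I : eqType)
    (X : I -> {RV P >-> V}) : Prop :=
  forall (J : seq I) (A : I -> set V), uniq J -> (forall i, measurable (A i)) ->
    P (\bigcap_(i in [set` J]) (X i @^-1` A i)) =
    (\prod_(i <- J) P (X i @^-1` A i))%E.

Definition identically_distributed (R : realType) d (T : measurableType d)
    (P : probability T R) d' (V : measurableType d') (I : Type)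
    (X : I -> {RV P >-> V}) : Prop :=
  forall (i j : I) (A : set V), measurable A ->
    P (X i @^-1` A) = P (X j @^-1` A).

Definition generated_by (R : realType) d (T : measurableType d)
    (P : probability T R) d' (V : measurableType d') (I : Type)
    (X : I -> {RV P >-> V}) : set (set T) :=
  <<s [set E | exists i : I, exists2 A : set V, measurable A & E = X i @^-1` A] >>.

(* [N] is independent of the whole family [X], i.e. sigma(N) is independent of
   the sigma-algebra generated by all the [X i] together. *)
Definition independent_of_family (R : realType) d (T : measurableType d)
    (P : probability T R) d' (U : measurableType d') (N : {RV P >-> U})
    d'' (V : measurableType d'') (I : Type) (X : I -> {RV P >-> V}) : Prop :=
  forall (B : set U) (E : set T), measurable B -> generated_by X E ->
    P ((N @^-1` B) `&` E) = (P (N @^-1` B) * P E)%E.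

Definition is_components (R : realType) (mu : probability R R) (n : nat)
    d (T : measurableType d) (P : probability T R)
    (X : 'I_n -> {RV P >-> R}) : Prop :=
  [/\ mutually_independent X,
      identically_distributed X &
      forall A : set R, measurable A ->
        P [set w | A (\sum_(i < n) X i w)] = mu A].

Definition infinitely_divisible (R : realType) (mu : probability R R) : Prop :=
  forall n : nat, (0 < n)%N ->
    exists d (T : measurableType d) (P : probability T R)
      (X : 'I_n -> {RV P >-> R}), is_components mu X.

Definition has_integer_components (R : realType) (mu : probability R R) : Prop :=
  forall n : nat, (0 < n)%N ->
    exists d (T : measurableType d) (P : probability T R)
      (X : 'I_n -> {RV P >-> R}),
      is_components mu X /\
      forall i : 'I_n, {ae P, forall w, exists k : nat, X i w = k%:R}.

(* A law on I_0 = {0, 1, 2, ...} is a [probability nat R] (every subset of [nat]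
   is measurable); [real_law] is the same law regarded as a law on the line. *)
Definition natR (R : realType) (k : nat) : R := k%:R.

Lemma measurable_natR (R : realType) : measurable_fun [set: nat] (@natR R).
Proof. by []. Qed.

HB.instance Definition _ (R : realType) :=
  isMeasurableFun.Build _ _ nat R (@natR R) (@measurable_natR R).

Definition real_law (R : realType) (mu : probability nat R) : probability R R :=
  distribution mu (@natR R).

Definition pgf (R : realType) (mu : probability nat R) (s : R) : R :=
  fine ('E_mu[fun k : nat => s ^+ k]).

(* The expectation defining a probability generating function converges
   absolutely for |s| <= 1, and the identity is between functions there. *)
Definition pgf_has_all_roots (R : realType) (mu : probability nat R) : Prop :=
  forall n : nat, (0 < n)%N ->
    exists nu : probability nat R,
      forall s : R, `|s| <= 1 -> pgf mu s = pgf nu s ^+ n.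

(* [Y 0], [Y 1], ... play the role of Y_1, Y_2, ... *)
Definition poisson_compound (R : realType) (mu : probability nat R) : Prop :=
  exists d (T : measurableType d) (P : probability T R)
    (lambda : R) (N : {RV P >-> nat}) (Y : nat -> {RV P >-> nat}),
    [/\ 0 < lambda,
        forall k : nat, P (N @^-1` [set k]) = (poisson_pmf lambda k)%:E,
        mutually_independent Y /\ identically_distributed Y,
        independent_of_family N Y &
        forall A : set nat, P [set w | A (\sum_(i < N w) Y i w)%N] = mu A].

(* Main.v *)
Require Import Defs.
From HB Require Import structures.
From mathcomp Require Import all_boot all_order all_algebra.
From mathcomp Require Import all_classical all_reals all_analysis.
From mathcomp Require Import measurable_realfun.
From mathcomp Require Import ring lra.

Set Implicit Arguments.
Unset Strict Implicit.
Unset Printing Implicit Defensive.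

Import Order.TTheory GRing.Theory Num.Theory.
Import numFieldNormedType.Exports.

Local Open Scope classical_set_scope.
Local Open Scope ring_scope.

(** Write [q m] for the masses of a law on the natural numbers and [Q] for its
    generating function.  All three properties (integer-valued components,
    generating-function roots, Poisson compound) are compared with a fourth,
    purely algebraic one: for every [n > 0] the sequence [q] is an [n]-fold
    convolution power of some law ([has_convolution_roots]).

    The law of a sum of [n] independent copies is the [n]-fold convolution power
    ([law_of_sum]).  This settles the components in one direction by recoding the
    real components as natural numbers, in the other by realising independent
    copies on the unit interval.  For generating functions, the partial sums of the
    power series of [Q_n ^ n] are compared with the powers of the partial sums of
    [Q_n], the error at [s] being at most the error at [1], where everything tends
    to [1] ([pgf_cpow]); conversely a generating function determines its law
    ([pgf_inj]).

    The heart of the matter is the logarithmic derivative: the formal identity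
    [Q' = L * Q] determines a probability law once [L] is given
    ([log_derivative_law_unique]), and
    - for the Poisson compound [exp (lambda * (R - 1))] it holds with
      [L = lambda * R'] ([compound_log_derivative], known as Panjer's recursion),
      whose coefficients are nonnegative;
    - it is multiplied by [n] when [Q] is replaced by [Q ^ n]
      ([log_derivative_cpow]).

    Hence the convolution root of order [n] of the Poisson compound with
    parameter [lambda] is the one with parameter [lambda / n] and the same
    summands.  Conversely, if [Q] has roots [Q_n] of all orders, then
    [Q 0 > 0], so that [L = Q' / Q] makes sense, and [L * Q_n = n * Q_n'] has
    nonnegative coefficients.  Since [Q_n 0 ^ n = Q 0], the law of [Q_n]
    concentrates at [0] as [n] grows, so [L] itself has nonnegative coefficients
    ([log_derivative_ge0]).  The recursion then yields
    [L j / (j + 1) <= q (j + 1) / q 0], so the primitive of [L] is summable and can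
    be normalised to the generating function of a law [p]
    ([convolution_roots_jump_rates]); the Poisson compound built from [p] has the
    logarithmic derivative [L], hence is the given law.

    A Poisson compound needs infinitely many independent variables.  They are read
    off the digits of a point of the unit interval in a generalised expansion:
    the interval is cut into consecutive cells of lengths [p 0, p 1, ...], the
    first digit is the number of the cell, and the cell is stretched affinely back
    to the whole interval before the next digit is read ([splits_off_exists]). *)

(** * Convolution powers and formal logarithmic derivatives *)

Section ConvolutionPowers.
Context {R : comNzRingType}.
Implicit Types (a q L : nat -> R) (m n M : nat).

(** The coefficient of degree [m] in the [n]-th power of the formal power series
    with coefficients [a].  Only the coefficients up to degree [m] matter, so the
    series may be truncated to a polynomial. *)
Definition cpow a n m : R := ((\poly_(i < m.+1) a i) ^+ n)`_m.

Lemma coefM_low M (p p' q q' : {poly R}) :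
  (forall i, (i <= M)%N -> p`_i = p'`_i) ->
  (forall i, (i <= M)%N -> q`_i = q'`_i) ->
  forall i, (i <= M)%N -> (p * q)`_i = (p' * q')`_i.
Proof.
move=> pp' qq' i iM; rewrite !coefM; apply: eq_bigr => j _.
by rewrite pp' ?qq' // (leq_trans _ iM) ?leq_subr// -ltnS.
Qed.

Lemma coefX_low M (p p' : {poly R}) n :
  (forall i, (i <= M)%N -> p`_i = p'`_i) ->
  forall i, (i <= M)%N -> (p ^+ n)`_i = (p' ^+ n)`_i.
Proof.
by move=> pp'; elim: n => // n IH i iM; rewrite !exprS; exact: coefM_low iM.
Qed.

Lemma cpowE a n M m : (m <= M)%N ->
  cpow a n m = ((\poly_(i < M.+1) a i) ^+ n)`_m.
Proof.
move=> mM; apply: (@coefX_low m) => // i im.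
by rewrite !coef_poly !ltnS im (leq_trans im mM).
Qed.

Lemma cpow0 a m : cpow a 0 m = (m == 0%N)%:R.
Proof. by rewrite /cpow expr0 coef1. Qed.

Lemma cpowS a n m :
  cpow a n.+1 m = \sum_(j < m.+1) a j * cpow a n (m - j).
Proof.
rewrite [LHS]/cpow exprS coefM; apply: eq_bigr => j _.
by rewrite coef_poly ltn_ord (cpowE _ _ (leq_subr j m)).
Qed.

Lemma cpow_at0 a n : cpow a n 0 = a 0%N ^+ n.
Proof.
elim: n => [|n IH]; first by rewrite cpow0.
by rewrite cpowS big_ord1 IH exprS.
Qed.

Lemma cpow_low a n m : a 0%N = 0 -> (m < n)%N -> cpow a n m = 0.
Proof.
move=> a0; elim: n m => // n IH m mn; rewrite cpowS big_ord_recl a0 mul0r add0r.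
rewrite big1 // => j _; rewrite IH ?mulr0 // /bump /=.
rewrite -ltnS (leq_trans _ mn) // ltnS; case: m j {mn} => [[]|m j] //.
by rewrite subSS ltnS leq_subr.
Qed.

(** [(A ^ n)' = n * A' * A ^ (n - 1)], read coefficientwise. *)
Lemma cpow_deriv a n m :
  cpow a n m.+1 *+ m.+1 =
  (\sum_(j < m.+1) (a j.+1 *+ j.+1) * cpow a n.-1 (m - j)) *+ n.
Proof.
rewrite [cpow a n _]/cpow -coef_deriv deriv_exp coefMn coefM; congr (_ *+ _).
apply: eq_bigr => j _; rewrite coef_deriv coef_poly ltnS ltn_ord.
by rewrite -(cpowE _ _ (leq_trans (leq_subr j m) (leqnSn m))).
Qed.

(** The formal identity [Q' = L * Q], that is, [L = Q' / Q]. *)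
Definition log_derivative L q := forall m,
  q m.+1 *+ m.+1 = \sum_(j < m.+1) L j * q (m - j)%N.

(** [Q' = L * Q] gives [(Q ^ n)' = n * Q' * Q ^ (n - 1) = (n * L) * Q ^ n]; the
    series are truncated to polynomials long enough for the coefficient at hand. *)
Lemma log_derivative_cpow L q n : log_derivative L q ->
  log_derivative (fun j => L j *+ n) (cpow q n).
Proof.
move=> Lq m; pose Q := \poly_(i < m.+2) q i; pose LL := \poly_(i < m.+2) L i.
have dQ i : (i <= m)%N -> Q^`()`_i = (LL * Q)`_i.
  move=> im; rewrite coef_deriv coef_poly !ltnS im Lq coefM.
  apply: eq_bigr => j _; have ji : (j <= i)%N by rewrite -ltnS.
  rewrite !coef_poly !ltnS (leq_trans ji (leq_trans im _)) //.
  by rewrite (leq_trans (leq_subr _ _) (leq_trans im _)).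
case: n => [|n].
  by rewrite cpow0 mul0rn big1 // => j _; rewrite mulr0n mul0r.
rewrite [LHS](_ : _ = (Q ^+ n.+1)^`()`_m); last by rewrite coef_deriv.
rewrite deriv_exp coefMn (@coefM_low m _ (LL * Q) _ (Q ^+ n)) //.
rewrite -mulrA -exprS coefM -sumrMnl; apply: eq_bigr => j _.
have jm : (j <= m.+1)%N by rewrite ltnW.
rewrite coef_poly ltnS jm -cpowE ?mulrnAl //.
exact: leq_trans (leq_subr _ _) (leqnSn _).
Qed.

End ConvolutionPowers.

Section LogDerivativeField.
Context {F : numFieldType}.
Implicit Types (q L : nat -> F) (m n : nat).

(** A linear differential equation of order one: its solutions form a line. *)
Lemma log_derivative_proportional L q q' :
  log_derivative L q -> log_derivative L q' ->
  forall m, q m * q' 0%N = q' m * q 0%N.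
Proof.
move=> Lq Lq' m; elim/ltn_ind: m => -[|m] IH; first by rewrite mulrC.
apply/eqP; rewrite -(eqr_pMn2r (ltn0Sn m)); apply/eqP.
rewrite -!mulrnAl Lq Lq' !mulr_suml; apply: eq_bigr => j _.
by rewrite -!mulrA IH // ltnS leq_subr.
Qed.

Lemma log_derivative_unique L L' q : q 0%N != 0 ->
  log_derivative L q -> log_derivative L' q -> L =1 L'.
Proof.
move=> q0 Lq L'q m; elim/ltn_ind: m => m IH; apply: (mulIf q0).
have := Lq m; rewrite L'q !big_ord_recr /= subnn.
by under eq_bigr => j _ do rewrite -IH //; move=> /addrI.
Qed.

Lemma log_derivative_exists q : q 0%N != 0 -> exists L, log_derivative L q.
Proof.
move=> q0.
(* Step [m] of the recursion fixes the value at [m] and keeps the earlier ones;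
   the value at [i] is thus final from step [i + 1] on. *)
pose next m (L : nat -> F) i := if i == m
  then (q m.+1 *+ m.+1 - \sum_(j < m) L j * q (m - j)%N) / q 0%N else L i.
pose G := fix G m := if m is m'.+1 then next m' (G m') else fun=> 0.
have stable m i : (i < m)%N -> G m i = G i.+1 i.
  elim: m => // m IH; rewrite ltnS leq_eqVlt => /orP[/eqP -> //|im].
  by rewrite -IH // [LHS]/= /next ltn_eqF.
exists (fun i => G i.+1 i) => m; rewrite big_ord_recr /= {2}/next eqxx subnn.
rewrite divfK // addrC -[LHS]addr0 -addrA; congr (_ + _); rewrite addrC.
apply/esym/eqP; rewrite subr_eq0; apply/eqP.
by apply: eq_bigr => j _; rewrite stable.
Qed.

End LogDerivativeField.

(** * Laws on the natural numbers *)

Section CountablePartitions.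
Context {R : realType}.

Lemma measurable_fun_fibers d (T : measurableType d) (f : T -> nat) :
  (forall k, measurable (f @^-1` [set k])) -> measurable_fun setT f.
Proof.
move=> mf _ A _; rewrite setTI.
rewrite (_ : f @^-1` A = \bigcup_(k in A) f @^-1` [set k]).
  by apply: bigcup_measurable => k _.
by apply/seteqP; split=> x /=; [exists (f x)|case=> k Ak /= ->].
Qed.

Lemma pr_fin d (T : measurableType d) (P : probability T R) (E : set T) :
  measurable E -> P E = (fine (P E))%:E.
Proof. by move=> mE; rewrite fineK // fin_num_measure. Qed.

(** Conditioning on a countable partition, in the form of a real series. *)
Lemma series_partition d (T : measurableType d) (P : probability T R)
    (f : T -> nat) (E : set T) :
  (forall k, measurable (f @^-1` [set k])) -> measurable E ->
  series (fun k => fine (P (f @^-1` [set k] `&` E))) @ \oo --> fine (P E).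
Proof.
move=> mf mE; have mfE k : measurable (f @^-1` [set k] `&` E) by exact: measurableI.
have : (fun n => \sum_(0 <= k < n) P (f @^-1` [set k] `&` E))%E @ \oo --> P E.
  rewrite [in X in _ --> X](_ : E = \bigcup_k (f @^-1` [set k] `&` E)); last first.
    by apply/seteqP; split=> [x Ex|x [k _ []//]]; exists (f x).
  apply: measure_sigma_additive => //.
  by move=> i j _ _ [x [[/= <- _] [/= <- _]]].
rewrite {1}(pr_fin P mE) => /fine_cvgP[_]; apply: cvg_trans; apply: near_eq_cvg.
apply: nearW => n /=; rewrite seriesEnat /=.
by under eq_bigr => k _ do rewrite pr_fin //; rewrite sumEFin.
Qed.

End CountablePartitions.

Section LawsOnNat.
Context {R : realType}.
Implicit Types (mu nu : probability nat R) (s : R).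

Definition pmass mu k : R := fine (mu [set k]).

Lemma pmassE mu k : mu [set k] = (pmass mu k)%:E.
Proof. exact: pr_fin. Qed.

Lemma pmass_ge0 mu k : 0 <= pmass mu k.
Proof. exact: fine_ge0. Qed.

Lemma series_pmass mu : series (pmass mu) @ \oo --> (1 : R).
Proof.
have := @series_partition _ _ _ mu id setT (fun=> I) measurableT.
by rewrite probability_setT /=; under eq_fun do rewrite setIT.
Qed.

Lemma sum_pmass_le1 mu n : \sum_(k < n) pmass mu k <= 1.
Proof.
have c := series_pmass mu.
have h : series (pmass mu) n <= limn (series (pmass mu)).
  apply: nondecreasing_cvgn_le; last by apply/cvg_ex; exists 1.
  by apply: nondecreasing_series => k _ _; exact: pmass_ge0.
by move: h; rewrite (cvg_lim _ c) // seriesEord.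
Qed.

Lemma pmass_le1 mu k : pmass mu k <= 1.
Proof.
apply: le_trans (sum_pmass_le1 mu k.+1); rewrite big_ord_recr /= lerDr.
by apply: sumr_ge0 => i _; exact: pmass_ge0.
Qed.

Lemma probability_nat_ext mu nu : pmass mu =1 pmass nu -> forall A, mu A = nu A.
Proof.
move=> e A; rewrite (pr_fin mu) // (pr_fin nu) //; congr EFin.
have mA := @series_partition _ _ _ mu id A (fun=> I) I.
have nA := @series_partition _ _ _ nu id A (fun=> I) I.
apply: (cvg_unique (@norm_hausdorff _ _) mA).
apply: cvg_trans nA; apply: near_eq_cvg.
apply: nearW => n; rewrite !seriesEnat; apply: eq_bigr => k _ /=.
have [Ak|nAk] := pselect (A k).
  rewrite (_ : _ `&` _ = [set k]) -?/(pmass _ _) ?e //.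
  by apply/seteqP; split=> [x []|x /= ->].
rewrite (_ : _ `&` _ = set0) ?measure0 //.
by apply/seteqP; split=> [x [/= -> ]|].
Qed.

Lemma pgf_series mu s : `|s| <= 1 ->
  series (fun k => pmass mu k * s ^+ k) @ \oo --> pgf mu s.
Proof.
move=> s1; set u := fun k => _.
have cu : cvgn (series u).
  apply: normed_cvg; apply: (@series_le_cvg _ _ (pmass mu)) => //=.
  - exact: pmass_ge0.
  - move=> n; rewrite /u normrM ger0_norm ?pmass_ge0 //.
    by rewrite ler_piMr ?pmass_ge0 // normrX exprn_ile1.
  - by apply/cvg_ex; exists 1; exact: series_pmass.
have bigT : \bigcup_k [set k] = [set: nat].
  by apply/seteqP; split=> // x _; exists x.
suff -> : pgf mu s = limn (series u) by [].
rewrite /pgf unlock -bigT integral_bigcup //.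
- rewrite [X in fine X](_ : _ = (limn (series u))%:E) // -EFin_lim //.
  apply: congr_lim; apply/funext => n; rewrite /series /= -sumEFin.
  apply: eq_bigr => k _; rewrite (@eq_integral _ _ _ mu _ (cst (s ^+ k)%:E)).
    by rewrite integral_cst // [X in (_ * X)%E](pmassE mu k) -EFinM mulrC.
  by move=> x; rewrite inE => ->.
- by move=> i j _ _ [x [/= -> ->]].
- rewrite bigT; apply: (@le_integrable _ _ _ mu _ _ _ (cst 1%E)) => //.
  + by move=> x _ /=; rewrite lee_fin normr1 normrX exprn_ile1.
  + exact: finite_measure_integrable_cst.
Qed.

End LawsOnNat.

(** * Generating functions *)

Section GeneratingFunctions.
Context {R : realType}.
Implicit Types (mu nu : probability nat R) (s : R) (p : nat -> R).

Lemma coef_poly_pow_ge0 p n N k : (forall k, 0 <= p k) ->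
  0 <= ((\poly_(i < N) p i) ^+ n)`_k.
Proof.
move=> p0; elim: n k => [|n IH] k; first by rewrite expr0 coef1.
rewrite exprS coefM sumr_ge0 // => j _; rewrite mulr_ge0 //.
by rewrite coef_poly; case: ifP.
Qed.

(** The coefficients of degree less than [N] in the power of a truncation are
    those of the power of the full series; [K] bounds the size of the power. *)
Lemma horner_pow_split p n N : exists2 K, (N <= K)%N & forall s : R,
  (\poly_(i < N) p i).[s] ^+ n =
  \sum_(0 <= k < N) cpow p n k * s ^+ k +
  \sum_(N <= k < K) ((\poly_(i < N) p i) ^+ n)`_k * s ^+ k.
Proof.
set P := \poly_(i < N) p i.
exists (maxn N (size (P ^+ n))) => [|s]; first exact: leq_maxl.
rewrite -horner_exp (@horner_coef_wide _ (maxn N (size (P ^+ n)))) ?leq_maxr //.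
rewrite -(big_mkord xpredT (fun k => (P ^+ n)`_k * s ^+ k)).
rewrite (@big_cat_nat _ _ _ N) ?leq_maxl //=; congr (_ + _).
rewrite big_nat_cond [RHS]big_nat_cond; apply: eq_bigr => k /andP[/andP[_]].
by case: N @P => // N P; rewrite ltnS => kN _; rewrite (cpowE _ _ kN).
Qed.

(** The error is a combination of powers of [s] with nonnegative coefficients,
    hence largest at [s = 1]. *)
Lemma horner_pow_error p n N s : (forall k, 0 <= p k) -> `|s| <= 1 ->
  `|(\poly_(i < N) p i).[s] ^+ n - \sum_(0 <= k < N) cpow p n k * s ^+ k|
  <= (\poly_(i < N) p i).[1] ^+ n - \sum_(0 <= k < N) cpow p n k.
Proof.
move=> p0 s1; have [K NK e] := horner_pow_split p n N.
rewrite !e; under [X in _ <= X + _ - _]eq_bigr => k _ do rewrite expr1n mulr1.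
rewrite ![_ + _ - _]addrAC !subrr !add0r; apply: le_trans (ler_norm_sum _ _ _) _.
apply: ler_sum => k _; rewrite expr1n mulr1 normrM ger0_norm ?coef_poly_pow_ge0 //.
by rewrite ler_piMr ?coef_poly_pow_ge0 // normrX exprn_ile1.
Qed.

Lemma cvg_exprn (u : nat -> R) (l : R) n :
  u @ \oo --> l -> (fun k => u k ^+ n) @ \oo --> l ^+ n.
Proof.
move=> ul; elim: n => [|n IH]; first by rewrite expr0; exact: cvg_cst.
by rewrite exprS; under eq_fun do rewrite exprS; exact: cvgM.
Qed.

Lemma horner_pgf nu s : `|s| <= 1 ->
  (fun N => (\poly_(i < N) pmass nu i).[s]) @ \oo --> pgf nu s.
Proof.
move=> s1; rewrite (_ : (fun N => _) = series (fun k => pmass nu k * s ^+ k)).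
  exact: pgf_series.
by apply/funext => N; rewrite horner_poly seriesEord.
Qed.

Lemma pgf1 nu : pgf nu 1 = 1.
Proof.
have n1 : `|1 : R| <= 1 by rewrite normr1.
have h := @pgf_series _ nu _ n1; have := series_pmass nu.
have <- : (fun k => pmass nu k * 1 ^+ k) = pmass nu.
  by apply/funext => k; rewrite expr1n mulr1.
by move=> h'; exact: (cvg_unique (@norm_hausdorff _ _) h h').
Qed.

(** The truncation error at [s] is bounded by the one at [1], and the latter tends
    to [1 - 1] since both laws have total mass [1].  This takes the place of a
    product theorem for power series and covers the whole interval [[-1, 1]]. *)
Lemma pgf_cpow mu nu n : pmass mu =1 cpow (pmass nu) n ->
  forall s, `|s| <= 1 -> pgf mu s = pgf nu s ^+ n.
Proof.
move=> e s s1; have n1 : `|1 : R| <= 1 by rewrite normr1.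
pose err N := (\poly_(i < N) pmass nu i).[1] ^+ n -
  \sum_(0 <= k < N) cpow (pmass nu) n k.
pose diff N := (\poly_(i < N) pmass nu i).[s] ^+ n -
  \sum_(0 <= k < N) cpow (pmass nu) n k * s ^+ k.
have err0 : err @ \oo --> (0 : R).
  have -> : 0 = (1 : R) ^+ n - 1 by rewrite expr1n subrr.
  have h1 := cvg_exprn (n := n) (@horner_pgf nu _ n1); rewrite pgf1 in h1.
  apply: cvgB h1 _; have := series_pmass mu.
  by rewrite (_ : pmass mu = cpow (pmass nu) n) //; exact/funext.
have diff_lim : diff @ \oo --> pgf nu s ^+ n - pgf mu s.
  apply: cvgB (cvg_exprn (n := n) (@horner_pgf nu _ s1)) _.
  have := @pgf_series _ mu _ s1.
  by rewrite (_ : pmass mu = cpow (pmass nu) n) //; exact/funext.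
have diff0 : diff @ \oo --> (0 : R).
  apply: (@squeeze_cvgr _ _ _ _ (fun N => - err N) err) => //.
    apply: nearW => N; rewrite -ler_norml horner_pow_error // => k.
    exact: pmass_ge0.
  by rewrite -[X in _ --> X]oppr0; exact: cvgN.
apply/esym/eqP; rewrite -subr_eq0; apply/eqP.
exact: (cvg_unique (@norm_hausdorff _ _) diff_lim diff0).
Qed.

Lemma pgf_enclosure mu m s : 0 <= s <= 1 ->
  \sum_(0 <= k < m.+1) pmass mu k * s ^+ k <= pgf mu s
  <= \sum_(0 <= k < m.+1) pmass mu k * s ^+ k + s ^+ m.+1.
Proof.
move=> /andP[s0 s1]; have ns1 : `|s| <= 1 by rewrite ger0_norm.
have c := @pgf_series _ mu _ ns1.
have term0 k : 0 <= pmass mu k * s ^+ k by rewrite mulr_ge0 ?pmass_ge0 ?exprn_ge0.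
apply/andP; split.
  apply: (cvgr_to_ge c); exists m.+1 => // N /= mN.
  by apply: (nondecreasing_series (fun k _ _ => term0 k)).
apply: (cvgr_to_le c); exists m.+1 => // N /= mN.
rewrite /series /= (@big_cat_nat _ _ _ m.+1) //= lerD2l.
apply: (@le_trans _ _ (\sum_(m.+1 <= k < N) pmass mu k * s ^+ m.+1)).
  rewrite big_nat_cond [leRHS]big_nat_cond; apply: ler_sum => k /andP[/andP[mk _] _].
  by rewrite ler_wpM2l ?pmass_ge0 // ler_wiXn2l.
rewrite -mulr_suml ler_piMl ?exprn_ge0 //.
apply: le_trans (sum_pmass_le1 mu N).
rewrite -(big_mkord xpredT) (@big_cat_nat _ _ _ m.+1 0 N) //= lerDr.
by rewrite sumr_ge0 // => k _; exact: pmass_ge0.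
Qed.

(** If the masses below [m] agree, [pgf_enclosure] gives
    [`|pmass mu m - pmass nu m| * s ^+ m <= s ^+ m.+1]; then [s] tends to [0]. *)
Lemma pgf_inj mu nu : (forall s, `|s| <= 1 -> pgf mu s = pgf nu s) ->
  pmass mu =1 pmass nu.
Proof.
move=> e m; elim/ltn_ind: m => m IH.
have close s : 0 < s <= 1 -> `|pmass mu m - pmass nu m| <= s.
  move=> /andP[s0 s1]; have sm : 0 < s ^+ m by rewrite exprn_gt0.
  have s01 : 0 <= s <= 1 by rewrite ltW.
  have := pgf_enclosure mu m s01; have := pgf_enclosure nu m s01.
  rewrite e; last by rewrite ger0_norm // ltW.
  rewrite !big_nat_recr //=.
  have -> : \sum_(0 <= k < m) pmass mu k * s ^+ k =
      \sum_(0 <= k < m) pmass nu k * s ^+ k.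
    by rewrite !big_mkord; apply: eq_bigr => k _; rewrite IH.
  move=> /andP[h1 h2] /andP[h3 h4].
  rewrite -(ler_pM2r sm) -[X in _ * X <= _](gtr0_norm sm) -normrM mulrBl -exprS.
  by rewrite ler_norml; apply/andP; split; lra.
apply/eqP; rewrite -subr_eq0 -normr_le0; apply/ler_addgt0Pr => x x0; rewrite add0r.
have [x1|x1] := leP x 1; first by apply: close; rewrite x0.
by apply: le_trans (close 1 _) (ltW x1); rewrite ltr01 lexx.
Qed.

End GeneratingFunctions.

(** * The recursion of a Poisson compound *)

Section CompoundPoissonRecursion.
Context {R : realType}.
Implicit Types (mu nu : probability nat R) (p : nat -> R).

Definition has_convolution_roots mu := forall n, (0 < n)%N ->
  exists nu : probability nat R, pmass mu =1 cpow (pmass nu) n.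

(** The coefficients of [lambda * R'], the logarithmic derivative of
    [exp (lambda * (R - 1))], where [p] are the coefficients of [R]. *)
Definition jump_rates (lambda : R) p := fun j => lambda * (p j.+1 *+ j.+1).

Lemma pmass_neq0 mu : exists m, pmass mu m != 0.
Proof.
apply: contrapT => /forallNP z; have c := @series_pmass _ mu.
have e : pmass mu = fun=> 0.
  by apply/funext => m; apply/eqP; have /negP := z m; rewrite negbK.
have : series (pmass mu) @ \oo --> (0 : R).
  rewrite e (_ : series _ = cst 0); first exact: cvg_cst.
  by apply/funext => n; rewrite /series /= big1.
move/(cvg_unique (@norm_hausdorff _ _) c)/eqP; by rewrite oner_eq0.
Qed.

(** The two laws are proportional, and both have total mass [1].  If both masses at
    [0] vanished, the recursion would make all the masses vanish. *)
Lemma log_derivative_law_unique L mu nu :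
  log_derivative L (pmass mu) -> log_derivative L (pmass nu) ->
  pmass mu =1 pmass nu.
Proof.
move=> Lmu Lnu; have prop := log_derivative_proportional Lmu Lnu.
have e0 : pmass nu 0%N = pmass mu 0%N.
  have scale (rho : probability nat R) (c : R) :
      series (fun m => pmass rho m * c) @ \oo --> c.
    rewrite -[X in _ --> X]mul1r (_ : series _ = series (pmass rho) \* cst c).
      by apply: cvgM; [exact: series_pmass|exact: cvg_cst].
    by apply/funext => n; rewrite /series /= mulr_suml.
  apply: (cvg_unique (@norm_hausdorff _ _) (scale mu _)).
  rewrite (_ : (fun m => _) = fun m => pmass nu m * pmass mu 0%N); last exact/funext.
  exact: scale.
have [z|nz] := eqVneq (pmass mu 0%N) 0; last first.
  by move=> m; apply: (mulIf nz); rewrite -{1}e0 prop.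
have [m] := pmass_neq0 mu; suff -> : pmass mu m = 0 by rewrite eqxx.
elim/ltn_ind: m => -[//|m] IH; apply/eqP.
have := Lmu m; rewrite big1 => [/eqP|j _]; first by rewrite mulrn_eq0.
by rewrite IH ?mulr0 // ltnS leq_subr.
Qed.

Lemma poisson_pmfS (lambda : R) n : 0 < lambda ->
  poisson_pmf lambda n.+1 *+ n.+1 = lambda * poisson_pmf lambda n.
Proof.
move=> l0; rewrite /poisson_pmf l0 factS natrM exprS.
have h1 : n.+1%:R != 0 :> R by rewrite pnatr_eq0.
have h2 : n`!%:R != 0 :> R by rewrite pnatr_eq0 -lt0n fact_gt0.
by rewrite -mulr_natr; field; rewrite h2 /=.
Qed.

(** Conditionally on [n] summands the law is the convolution power [cpow p n], so
    the recursion combines [cpow_deriv] with [n * w n = lambda * w (n - 1)] for the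
    Poisson weights [w], and passes to the limit in the number of terms. *)
Lemma compound_log_derivative lambda p nu : 0 < lambda ->
  (forall m, series (fun n => poisson_pmf lambda n * cpow p n m) @ \oo -->
     pmass nu m) ->
  log_derivative (jump_rates lambda p) (pmass nu).
Proof.
move=> l0 hnu m; pose u m := series (fun n => poisson_pmf lambda n * cpow p n m).
have rec N : u m.+1 N.+1 *+ m.+1 =
    \sum_(j < m.+1) jump_rates lambda p j * u (m - j)%N N.
  rewrite /u /series /= -sumrMnl big_nat_recl // cpow0 mulr0 mul0rn add0r.
  under [RHS]eq_bigr => j _ do rewrite mulr_sumr.
  rewrite exchange_big /=; apply: eq_bigr => n _.
  rewrite -mulrnAr cpow_deriv mulrnAr -mulrnAl poisson_pmfS // mulr_sumr.
  by apply: eq_bigr => j _; rewrite /jump_rates /=; ring.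
have lim1 : (fun N => u m.+1 N.+1 *+ m.+1) @ \oo --> pmass nu m.+1 *+ m.+1.
  have -> : (fun N => u m.+1 N.+1 *+ m.+1) = fun N => u m.+1 N.+1 * m.+1%:R.
    by apply/funext => N; rewrite mulr_natr.
  rewrite -(mulr_natr (pmass _ _)).
  apply: cvgM; last exact: cvg_cst.
  by have := hnu m.+1; rewrite -cvg_shiftS.
apply: (cvg_unique (@norm_hausdorff _ _) lim1).
rewrite (_ : (fun N => _) =
  fun N => \sum_(j < m.+1) jump_rates lambda p j * u (m - j)%N N); last exact/funext.
apply: (cvg_big (@add_continuous _)) => j _; apply: cvgM; first exact: cvg_cst.
exact: hnu.
Qed.

(** If the mass at [0] vanished, so would that of every root; a root of order [n]
    would then live on the positive integers and its [n]-fold convolution on the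
    integers at least [n], for every [n]. *)
Lemma convolution_roots_pmass0 mu : has_convolution_roots mu -> 0 < pmass mu 0%N.
Proof.
move=> roots; rewrite lt0r pmass_ge0 andbT; apply/eqP => mu0.
have [m /eqP] := pmass_neq0 mu; apply.
have [nu e] := roots m.+1 isT; rewrite e cpow_low //.
by apply/eqP; move/eqP: (e 0%N); rewrite mu0 cpow_at0 eq_sym expf_eq0.
Qed.

(** [1 - x ^+ n = (1 - x) * (1 + x + ... + x ^+ n.-1)], each term of the sum being
    at least [x ^+ n]. *)
Lemma one_sub_le_of_pow (x : R) n : 0 <= x <= 1 ->
  (1 - x) * x ^+ n *+ n <= 1.
Proof.
move=> /andP[x0 x1]; apply: (@le_trans _ _ (1 - x ^+ n)); last first.
  by rewrite gerBl exprn_ge0.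
rewrite -opprB -[in leRHS]opprB subrX1 -mulNr -mulrnAr opprB.
rewrite ler_wpM2l ?subr_ge0 // -[n in _ *+ n]card_ord -sumr_const.
by apply: ler_sum => i _; rewrite ler_wiXn2l // ltnW.
Qed.

(** Let [q] and [x] be the masses at [0] of [mu] and of a root [nu] of order [n].
    Since [L * nu = n * nu'] has nonnegative coefficients and [nu] has mass [1 - x]
    off [0], one gets [- L m * x <= C * (1 - x)] with [C] independent of [n].  As
    [x ^+ n = q], the gap [1 - x] is at most [1 / (n * q)], so [- L m > 0] would
    bound every [n]. *)
Lemma log_derivative_ge0 mu L : has_convolution_roots mu ->
  log_derivative L (pmass mu) -> forall m, 0 <= L m.
Proof.
move=> roots Lmu m; have q0 := convolution_roots_pmass0 roots.
set q := pmass mu 0%N in q0; pose C := \sum_(j < m) `|L j|.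
rewrite leNgt; apply/negP => Lm0.
suff bound n : (0 < n)%N -> n%:R <= C / (- L m * q ^+ 2).
  have := archi_boundP (x := C / (- L m * q ^+ 2)) _; set N := Num.bound _.
  have Cp : 0 <= C / (- L m * q ^+ 2).
    by rewrite divr_ge0 ?sumr_ge0 // mulr_ge0 ?sqr_ge0 // oppr_ge0 ltW.
  move=> /(_ Cp) /(le_lt_trans (bound N.+1 isT)).
  by rewrite ltr_nat ltnNge leqnSn.
move=> n0; have [nu e] := roots n n0; set x := pmass nu 0%N.
have xn : x ^+ n = q by rewrite /x -cpow_at0 -e.
have x01 : 0 <= x <= 1 by rewrite pmass_ge0 pmass_le1.
have qx : q <= x.
  by case/andP: x01 => x0 x1; rewrite -xn -[leRHS]expr1 ler_wiXn2l.
have gap : (1 - x) * q *+ n <= 1 by rewrite -xn one_sub_le_of_pow.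
have x0 : x != 0 by rewrite gt_eqF // (lt_le_trans q0).
have [M LM] := log_derivative_exists x0.
have eL j : L j = M j *+ n.
  apply: (@log_derivative_unique _ L (fun j => M j *+ n) (pmass mu)) => //.
    by rewrite gt_eqF.
  rewrite (_ : pmass mu = cpow (pmass nu) n); last exact/funext.
  exact: log_derivative_cpow.
have tail : - L m * x <= C * (1 - x).
  have : 0 <= (pmass nu m.+1 *+ m.+1) *+ n by rewrite !mulrn_wge0 ?pmass_ge0.
  rewrite LM -sumrMnl; under eq_bigr => j _ do rewrite -mulrnAl -eL.
  rewrite big_ord_recr /= subnn -/x => h.
  apply: (@le_trans _ _ (\sum_(j < m) L j * pmass nu (m - j)%N)).
    by rewrite mulNr; lra.
  rewrite mulr_suml; apply: ler_sum => j _.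
  apply: le_trans (ler_norm _) _; rewrite normrM ler_wpM2l //.
  rewrite ger0_norm ?pmass_ge0 // lerBrDl.
  apply: le_trans (sum_pmass_le1 nu (m - j).+1).
  have mj : (0 < m - j)%N by rewrite subn_gt0.
  case: (m - j)%N mj => // k _.
  rewrite big_ord_recl big_ord_recr /= lerD2l lerDr.
  by apply: sumr_ge0 => i _; exact: pmass_ge0.
have nLq : 0 < - L m * q ^+ 2 by rewrite mulr_gt0 ?exprn_gt0 // oppr_gt0.
rewrite ler_pdivlMr //; have C0 : 0 <= C by apply: sumr_ge0.
have h : - L m * q <= C * (1 - x).
  by apply: le_trans tail; rewrite ler_wpM2l // oppr_ge0 ltW.
apply: (@le_trans _ _ (C * ((1 - x) * q *+ n))); last by rewrite ler_piMr.
have -> : C * ((1 - x) * q *+ n) = n%:R * (C * (1 - x) * q) by ring.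
by rewrite ler_wpM2l ?ler0n // expr2 mulrA ler_wpM2r // ltW.
Qed.

(** The intensity is [1] plus the sum of the [L j / (j + 1)], the extra [1] being
    the weight of jumps of size [0]: these do not change the compound law, and they
    keep the intensity positive also when [L = 0]. *)
Lemma convolution_roots_jump_rates mu : has_convolution_roots mu ->
  exists lambda, exists p : nat -> R,
  [/\ 0 < lambda, forall k, 0 <= p k, series p @ \oo --> (1 : R) &
      log_derivative (jump_rates lambda p) (pmass mu)].
Proof.
move=> roots; have q0 := convolution_roots_pmass0 roots.
have [L Lmu] := log_derivative_exists (lt0r_neq0 q0).
have L0 := log_derivative_ge0 roots Lmu.
pose a j := if j is i.+1 then L i / i.+1%:R else 1.
have a0 j : 0 <= a j by case: j => [|j] //=; rewrite divr_ge0.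
pose b j := (j == 0%N)%:R + pmass mu j / pmass mu 0%N.
(* In the recursion for [q j.+1] all the terms are nonnegative, and one of them
   is [L j * q 0]. *)
have ab j : a j <= b j.
  rewrite /a /b; case: j => [|j] /=; first by rewrite divff ?gt_eqF // lerDl.
  rewrite add0r ler_pdivlMr // mulrAC ler_pdivrMr // mulr_natr Lmu.
  rewrite big_ord_recr /= subnn lerDr sumr_ge0 // => i _.
  by rewrite mulr_ge0 ?pmass_ge0.
have cb : cvgn (series b).
  have -> : series b = series (fun j => (j == 0%N)%:R) +
      (fun n => series (pmass mu) n / pmass mu 0%N).
    by apply/funext => n; rewrite /series /b /= big_split /= -mulr_suml.
  apply: is_cvgD; last first.
    apply: is_cvgM; last exact: is_cvg_cst.
    by apply/cvg_ex; exists 1; exact: series_pmass.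
  apply/cvg_ex; exists 1; rewrite -cvg_shiftS.
  rewrite (_ : (fun n => _) = cst (1 : R)); first exact: cvg_cst.
  apply/funext => n; rewrite /series /= big_nat_recl // big1 ?addr0 //.
have ca : cvgn (series a).
  by apply: (series_le_cvg _ _ ab cb) => // j; exact: le_trans (ab j).
set lambda := limn (series a) in ca.
have lambda0 : 0 < lambda.
  apply: (@lt_le_trans _ _ (series a 1%N)).
    by rewrite /series /= big_nat1 ltr01.
  by apply: nondecreasing_cvgn_le ca _; apply: nondecreasing_series => j _ _.
exists lambda, (fun j => a j / lambda); split=> //.
- by move=> k; rewrite divr_ge0 // ltW.
- have -> : series (fun j => a j / lambda) = fun n => series a n / lambda.
    by apply/funext => n; rewrite /series /= mulr_suml.
  rewrite -[X in _ --> X](divff (lt0r_neq0 lambda0)).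
  by apply: cvgM; [exact: ca|exact: cvg_cst].
- rewrite (_ : jump_rates _ _ = L) //; apply/funext => j.
  rewrite /jump_rates /a -mulr_natr; field.
  by rewrite gt_eqF //= addrC natr1 pnatr_eq0.
Qed.

End CompoundPoissonRecursion.

(** * Independent digits of a uniform point *)

Section DigitAndShift.
Context {R : realType}.
Implicit Types (p : nat -> R).

(** The default value [0] outside all the [B k] keeps the fibers measurable. *)
Lemma selector_exists d (T : measurableType d) (B : nat -> set T) :
  (forall k, measurable (B k)) -> trivIset setT B ->
  exists f : T -> nat, (forall k, measurable (f @^-1` [set k])) /\
    forall k x, B k x -> f x = k.
Proof.
move=> mB tB.
pose f x := if pselect (exists k, B k x) is left h then projT1 (cid h) else 0%N.
have fB k x : B k x -> f x = k.
  move=> Bkx; rewrite /f; case: pselect => [h|[]]; last by exists k.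
  case: (cid h) => j Bjx /=; apply: (tB j k I I).
  by exists x.
exists f; split=> // k.
have ->: f @^-1` [set k] =
    B k `|` (if k is 0%N then ~` \bigcup_k B k else set0).
  apply/seteqP; split=> x /=.
  - rewrite /f; case: pselect => [h <-|nB <-]; first by left; case: (cid h).
    by right => -[j _ Bjx]; apply: nB; exists j.
  - case=> [/fB //|]; case: k => //= nB; rewrite /f.
    by case: pselect => // h; case: nB; case: (h) => j Bj; exists j.
apply: measurableU; first exact: mB; case: k => [|k]; last exact: measurable0.
by apply: measurableC; exact: bigcupT_measurable.
Qed.

(** The interval is closed on the left only, so that the cells
    [[F k, F k.+1[] tile it exactly. *)
Definition unit_lebesgue :=
  mrestr (@lebesgue_measure R) (measurable_itv (Interval (BLeft 0%R) (BLeft 1%R))).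

HB.instance Definition _ := Measure.on unit_lebesgue.

Lemma unit_lebesgueT : unit_lebesgue setT = 1%E.
Proof.
rewrite /unit_lebesgue /mrestr setTI lebesgue_measure_itv /= lte_fin ltr01.
by rewrite oppr0 adde0.
Qed.

HB.instance Definition _ :=
  Measure_isProbability.Build _ _ _ unit_lebesgue unit_lebesgueT.

(** Both sides, divided by [a], are measures in [C] that agree on intervals. *)
Lemma lebesgue_measure_affine (c a : R) (C : set R) : 0 < a -> measurable C ->
  lebesgue_measure ((fun x => (x - c) / a) @^-1` C) =
  (a%:E * lebesgue_measure C)%E.
Proof.
move=> a0 mC; pose g := fun x : R => (x - c) / a.
have mg : measurable_fun (setT : set (measurableTypeR R))
    (g : _ -> measurableTypeR R).
  by apply: measurable_funM => //; apply: measurable_funB.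
have ai0 : 0 <= a^-1 by rewrite invr_ge0 ltW.
pose m0 : {measure set (measurableTypeR R) -> \bar R} :=
  mscale (NngNum ai0) (pushforward lebesgue_measure
    (g : measurableTypeR R -> measurableTypeR R)).
pose m := m0 mg.
have -> : lebesgue_measure C = m C.
  apply: lebesgue_measure_unique => // _ [[u v] /= _ <-].
  rewrite /m /m0 /mscale /= /pushforward.
  rewrite (_ : g @^-1` _ = `]c + a * u, c + a * v]%classic); last first.
    apply/seteqP; split=> x; rewrite /= !in_itv /= /g ltr_pdivlMr // ler_pdivrMr //;
      by move=> /andP[h1 h2]; apply/andP; split; lra.
  rewrite !lebesgue_measure_itv /= !lte_fin ltrD2l ltr_pM2l //.
  case: ifP => _; last by rewrite mule0.
  by rewrite -!EFinD -EFinM; congr EFin; field; rewrite gt_eqF.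
by rewrite /m /m0 /mscale /= muleA -EFinM divff ?gt_eqF // mul1e.
Qed.

Local Notation U := (measurableTypeR R).
Local Notation P := (unit_lebesgue : probability U R).

Lemma unit_lebesgueE (A : set U) :
  P A = lebesgue_measure (A `&` `[0, 1[%classic).
Proof. by []. Qed.

(** Under the uniform law the first digit has law [q], and given the digit the
    shifted point is again uniform. *)
Definition splits_off (q : nat -> R) (dig : U -> nat) (shift : U -> U) :=
  [/\ forall k, measurable (dig @^-1` [set k]), measurable_fun setT shift &
      forall k C, measurable C ->
        P (dig @^-1` [set k] `&` shift @^-1` C) = ((q k)%:E * P C)%E].

(** With [F] the cumulative sums of [p], the cell of number [k] is
    [[F k, F k.+1[], and the shift restricted to it is the affine map onto
    [[0, 1[], which multiplies Lebesgue measure by [(p k)^-1].  A cell of length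
    [0] is empty. *)
Lemma splits_off_exists p : (forall k, 0 <= p k) -> series p @ \oo --> (1 : R) ->
  exists dig, exists shift, splits_off p dig shift.
Proof.
move=> p0 p1; pose F := series p.
have F0 : F 0%N = 0 by rewrite /F /series /= big_geq.
have FS k : F k.+1 = F k + p k by rewrite /F /series /= big_nat_recr.
have Fmono : {homo F : i j / (i <= j)%N >-> i <= j}.
  by apply: nondecreasing_series => k _ _.
have F1 k : F k <= 1.
  rewrite -(cvg_lim _ p1) //; apply: nondecreasing_cvgn_le => //.
  by apply/cvg_ex; exists 1.
pose B k : set U := `[F k, F k.+1[%classic.
have mB k : measurable (B k) by exact: measurable_itv.
have tB : trivIset setT B.
  move=> i j _ _ [x []]; rewrite /B /= !in_itv /= => /andP[i1 i2] /andP[j1 j2].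
  by case: (ltngtP i j) => // /Fmono h; exfalso; lra.
have [dig [mdig digB]] := selector_exists mB tB.
have cover (x : U) : 0 <= x < 1 -> B (dig x) x.
  move=> /andP[x0 x1]; have ex : exists k, x < F k.
    have := cvgr_gt _ p1 _ x1; case=> N _ h; exists N; exact: (h N (leqnn N)).
  case: (ex_minnP ex) => -[|k] xk kmin; first by move: xk; rewrite F0 ltNge x0.
  have Bk : B k x.
    by rewrite /B /= in_itv /= xk andbT leNgt; apply/negP => /kmin; rewrite ltnn.
  by rewrite (digB _ _ Bk).
pose shift (x : U) : U := (x - F (dig x)) / p (dig x).
have shiftE k C : dig @^-1` [set k] `&` shift @^-1` C =
    dig @^-1` [set k] `&` (fun x => (x - F k) / p k) @^-1` C.
  by apply/seteqP; split=> x /= [e h]; split=> //; move: h; rewrite /shift e.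
have mg k : measurable_fun (setT : set U) (fun x : U => (x - F k) / p k : U).
  by apply: measurable_funM => //; apply: measurable_funB.
exists dig, shift; split=> //.
- move=> _ C mC; rewrite setTI.
  have -> : shift @^-1` C = \bigcup_k (dig @^-1` [set k] `&` shift @^-1` C).
    by apply/seteqP; split=> [x Cx|x [k _ []//]]; exists (dig x).
  apply: bigcup_measurable => k _; rewrite shiftE; apply: measurableI => //.
  by rewrite -[X in measurable X]setTI; exact: mg.
- move=> k C mC; rewrite [in LHS]shiftE !unit_lebesgueE.
  have [pk|pk] := eqVneq (p k) 0.
    rewrite pk mul0e (_ : _ `&` _ = set0) ?measure0 //.
    apply/seteqP; split=> // x [[/= dk _]]; rewrite /= in_itv /= => /cover.
    by rewrite dk /B /= in_itv /= FS pk addr0 => /andP[h]; rewrite ltNge h.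
  have pk0 : 0 < p k by rewrite lt0r pk p0.
  rewrite -(lebesgue_measure_affine (F k) pk0); last first.
    by apply: measurableI => //; exact: measurable_itv.
  congr (lebesgue_measure _); apply/seteqP; split=> x /=.
  + move=> [[dk Cx]]; rewrite /= in_itv /= => /cover; rewrite dk /B /= !in_itv /= FS.
    move=> /andP[h1 h2]; split=> //.
    by rewrite ler_pdivlMr // ltr_pdivrMr //; apply/andP; split; lra.
  + rewrite !in_itv /= ler_pdivlMr // ltr_pdivrMr // => -[Cx /andP[h1 h2]].
    have Bk : B k x by rewrite /B /= in_itv /= FS; apply/andP; split; lra.
    split; first by split=> //; exact: digB Bk.
    move: Bk; rewrite /B /= in_itv /= => /andP[h3 h4]; have := F1 k.+1.
    by have := Fmono 0%N k (leq0n k); rewrite F0 => h5 h6; apply/andP; split; lra.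
Qed.

Section SplitsOff.
Variables (q : nat -> R) (dig : U -> nat) (shift : U -> U).
Hypothesis ds : splits_off q dig shift.

Lemma measurable_shift C : measurable C -> measurable (shift @^-1` C).
Proof. by case: ds => _ h _ mC; rewrite -[X in measurable X]setTI; exact: h. Qed.

Lemma measurable_dig A : measurable (dig @^-1` A).
Proof.
case: ds => h _ _; rewrite -[X in measurable X]setTI.
exact: (measurable_fun_fibers h).
Qed.

Lemma splits_off_law k : P (dig @^-1` [set k]) = (q k)%:E.
Proof.
case: ds => _ _ /(_ k _ measurableT); rewrite preimage_setT setIT.
by rewrite probability_setT mule1.
Qed.

Lemma splits_off_indep A C : measurable C ->
  P (dig @^-1` A `&` shift @^-1` C) = (P (dig @^-1` A) * P C)%E.
Proof.
move=> mC; have mA := measurable_dig A; have mS := measurable_shift mC.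
rewrite (pr_fin P (measurableI _ _ mA mS)) (pr_fin P mA) (pr_fin P mC) -EFinM.
congr EFin; case: (ds) => mdig _ qP.
have h1 := @series_partition _ _ _ P _ _ mdig (measurableI _ _ mA mS).
have h2 := cvgM (@series_partition _ _ _ P _ _ mdig mA)
  (@cvg_cst _ (fine (P C)) _ \oo _).
apply: (cvg_unique (@norm_hausdorff _ _) h1).
rewrite (_ : series _ = (fun N => series
  (fun k => fine (P (dig @^-1` [set k] `&` dig @^-1` A))) N * fine (P C))).
  exact: h2.
apply/funext => N; rewrite /series /= mulr_suml; apply: eq_bigr => k _.
rewrite setIA; have [Ak|nAk] := pselect (A k).
  have -> : dig @^-1` [set k] `&` dig @^-1` A = dig @^-1` [set k].
    by apply/seteqP; split=> [x []//|x /= e]; split=> //=; rewrite e.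
  by rewrite splits_off_law qP // (pr_fin P mC) -EFinM.
have -> : dig @^-1` [set k] `&` dig @^-1` A = set0.
  by apply/seteqP; split=> // x [/= ->].
by rewrite set0I measure0 mul0r.
Qed.

Lemma shift_preserves C : measurable C -> P (shift @^-1` C) = P C.
Proof.
move=> mC; have := splits_off_indep setT mC.
by rewrite preimage_setT setTI probability_setT mul1e.
Qed.

Definition digit i x := dig (iter i shift x).

Lemma measurable_digit i A : measurable (digit i @^-1` A).
Proof.
elim: i => [|i IH]; first exact: measurable_dig.
rewrite (_ : _ @^-1` A = shift @^-1` (digit i @^-1` A)).
  exact: measurable_shift.
by apply/seteqP; split=> x; rewrite /digit /= -iterSr.
Qed.

Lemma digit_law i A : P (digit i @^-1` A) = P (dig @^-1` A).
Proof.
elim: i => // i IH.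
rewrite (_ : _ @^-1` A = shift @^-1` (digit i @^-1` A)).
  by rewrite shift_preserves ?IH //; exact: measurable_digit.
by apply/seteqP; split=> x; rewrite /digit /= -iterSr.
Qed.

Lemma measurable_digits n (A : nat -> set nat) :
  measurable (\bigcap_(i in `I_n) (digit i @^-1` A i)).
Proof. by apply: bigcap_measurableType => i _; exact: measurable_digit. Qed.

(** The later digits are functions of the shifted point, which is uniform and
    independent of the first digit. *)
Lemma digits_independent n (A : nat -> set nat) :
  P (\bigcap_(i in `I_n) (digit i @^-1` A i)) =
  (\prod_(i < n) P (dig @^-1` A i))%E.
Proof.
elim: n A => [|n IH] A.
  by rewrite II0 bigcap_set0 big_ord0 probability_setT.
rewrite (_ : \bigcap_(i in _) _ = dig @^-1` A 0%N `&`
    shift @^-1` (\bigcap_(i in `I_n) (digit i @^-1` A i.+1))).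
  rewrite splits_off_indep ?IH ?big_ord_recl //.
  by apply: bigcap_measurableType => i _; exact: measurable_digit.
apply/seteqP; split=> x.
- move=> h; split; first exact: (h 0%N).
  by move=> i ilt; have := h i.+1 ilt; rewrite /digit /= -iterS iterSr.
- move=> [h0 h] [|i] ilt //; have := h i ilt.
  by rewrite /digit /= -iterSr.
Qed.

End SplitsOff.

End DigitAndShift.

(** * Sums of independent variables *)

Section SumsOfIndependentVariables.
Context {R : realType}.

Definition nat_rv d (T : measurableType d) (f : T -> nat)
    (mf : forall k, measurable (f @^-1` [set k])) : {mfun T >-> nat} :=
  HB.pack_for {mfun T >-> nat} f
    (isMeasurableFun.Build _ _ T nat f (measurable_fun_fibers mf)).

Lemma measurable_rv d d' (T : measurableType d) (V : measurableType d')
    (X : {mfun T >-> V}) A : measurable A -> measurable (X @^-1` A).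
Proof.
by move=> mA; rewrite -[X in measurable X]setTI; exact: measurable_funPT.
Qed.

(** The sample space is a parameter so that the sigma-algebra generated by a family
    of variables can take the place of the ambient one. *)
Lemma sum_fibers_measurable d (T : measurableType d) (Y : nat -> T -> nat) :
  (forall i k, measurable (Y i @^-1` [set k])) ->
  forall n m, measurable [set w | \sum_(i < n) Y i w = m]%N.
Proof.
move=> mY; elim=> [|n IH] m.
  case: m => [|m].
    rewrite (_ : [set _ | _] = setT) //.
    by apply/seteqP; split=> w //= _; rewrite big_ord0.
  rewrite (_ : [set _ | _] = set0) //.
  by apply/seteqP; split=> w //=; rewrite big_ord0.
rewrite (_ : [set _ | _] = \bigcup_(k in [set k | (k <= m)%N])
    ([set w | \sum_(i < n) Y i w = m - k]%N `&` Y n @^-1` [set k])).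
  by apply: bigcup_measurable => k _; exact: measurableI.
apply/seteqP; split=> w /=.
- rewrite big_ord_recr /= => e; exists (Y n w); first by rewrite /= -e leq_addl.
  by split=> //=; rewrite -e addnK.
- by move=> [k /= km [/= e1 e2]]; rewrite big_ord_recr /= e1 e2 subnK.
Qed.

(** By induction on [J].  Splitting according to the value of one summand
    conditions the remaining sum on an event about that summand, so the induction
    carries along arbitrary events on the variables with indices in a second list
    [J'] disjoint from the first. *)
Lemma law_of_sum d (T : measurableType d) (P : probability T R) (I : eqType)
    (Y : I -> {RV P >-> nat}) (p : nat -> R) : mutually_independent Y ->
  forall J : seq I, uniq J ->
  (forall i k, i \in J -> P (Y i @^-1` [set k]) = (p k)%:E) ->
  forall m, measurable [set w | \sum_(i <- J) Y i w = m]%N /\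
    P [set w | \sum_(i <- J) Y i w = m]%N = (cpow p (size J) m)%:E.
Proof.
move=> indY J uJ lawY m.
pose S J m := [set w | \sum_(i <- J) Y i w = m]%N.
have mcap (J' : seq I) (A : I -> set nat) :
    measurable (\bigcap_(i in [set` J']) (Y i @^-1` A i)).
  elim: J' => [|i J' IH]; first by rewrite set_nil bigcap_set0.
  rewrite (_ : bigcap _ _ = Y i @^-1` A i `&`
      \bigcap_(i in [set` J']) (Y i @^-1` A i)).
    by apply: measurableI => //; exact: measurable_rv.
  apply/seteqP; split=> w.
    move=> h; split; first by apply: h; rewrite /= mem_head.
    by move=> l /= lJ'; apply: h; rewrite /= inE lJ' orbT.
  by move=> [hi h] l; rewrite /= inE => /orP[/eqP ->|/h].
have dec i J1 k : S (i :: J1) k =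
    \big[setU/set0]_(j < k.+1) (Y i @^-1` [set (j : nat)] `&` S J1 (k - j)%N).
  rewrite -(bigcup_mkord k.+1 (fun j => Y i @^-1` [set j] `&` S J1 (k - j)%N)).
  apply/seteqP; split=> w; rewrite /S /= big_cons.
    by move=> e; exists (Y i w); rewrite /= -?e ?ltnS ?leq_addr // addKn.
  by move=> [j /= jk [/= -> ->]]; rewrite subnKC.
have mS J1 k : measurable (S J1 k).
  elim: J1 k => [|i J1 IH] k.
    have [->|k0] := eqVneq k 0%N.
      rewrite (_ : S _ _ = setT) //.
      by apply/seteqP; split=> w // _; rewrite /S /= big_nil.
    rewrite (_ : S _ _ = set0) //.
    apply/seteqP; split=> w //; rewrite /S /= big_nil => /esym/eqP.
    by rewrite (negbTE k0).
  rewrite dec; apply: bigsetU_measurable => j _; apply: measurableI => //.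
  exact: measurable_rv.
split; first exact: mS.
suff gen (J1 J' : seq I) (A : I -> set nat) k :
    uniq (J1 ++ J') -> {subset J1 <= J} ->
    P (S J1 k `&` \bigcap_(i in [set` J']) (Y i @^-1` A i)) =
    ((cpow p (size J1) k)%:E * \prod_(i <- J') P (Y i @^-1` A i))%E.
  have := gen J [::] (fun=> setT) m; rewrite cats0 big_nil mule1.
  by rewrite set_nil bigcap_set0 setIT; apply.
elim: J1 J' A k => [|i J1 IH] J' A k uJ1 sJ.
  rewrite cpow0; have [->|k0] := eqVneq k 0%N.
    rewrite mul1e (_ : S _ _ = setT) ?setTI; first exact: indY.
    by apply/seteqP; split=> w // _; rewrite /S /= big_nil.
  rewrite mul0e (_ : S _ _ = set0) ?set0I ?measure0 //.
  apply/seteqP; split=> w //; rewrite /S /= big_nil => /esym/eqP.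
  by rewrite (negbTE k0).
have iJ : i \in J by apply: sJ; rewrite mem_head.
have [iJ1 [iJ' uJ1']] : i \notin J1 /\ i \notin J' /\ uniq (J1 ++ J').
  by move: uJ1; rewrite /= mem_cat negb_or => /andP[/andP[]].
have uJ' : uniq J' by move: uJ1'; rewrite cat_uniq => /and3P[].
pose A' (j : nat) l := if l == i then [set j : nat] else A l.
have termE (j : nat) : Y i @^-1` [set j] `&` S J1 (k - j)%N `&`
    \bigcap_(l in [set` J']) (Y l @^-1` A l) =
    S J1 (k - j)%N `&` \bigcap_(l in [set` i :: J']) (Y l @^-1` A' j l).
  apply/seteqP; split=> w.
    move=> [[/= wi wS] wA]; split=> // l /=; rewrite inE /A'.
    by case: eqP => [->|_ /= lJ']; [|exact: wA].
  move=> [wS wA]; split; first split=> //.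
    by have := wA i; rewrite /= mem_head /A' eqxx; apply.
  move=> l /= lJ'; have := wA l; rewrite /= inE lJ' orbT /A'.
  by case: eqP => [li|_]; [rewrite -li lJ' in iJ'|apply].
rewrite dec setIC big_distrr /= measure_bigsetU_ord; last 2 first.
- move=> j; apply: measurableI => //; apply: measurableI => //.
  exact: measurable_rv.
- move=> j1 j2 _ _ [w [[_ [/= e1 _]] [_ [/= e2 _]]]].
  by apply: val_inj; rewrite /= -e1 -e2.
have [c prodE] : exists c, (\prod_(l <- J') P (Y l @^-1` A l))%E = c%:E.
  by rewrite -indY //; eexists; exact: pr_fin.
rewrite prodE -EFinM cpowS mulr_suml -sumEFin; apply: eq_bigr => j _.
transitivity (P (S J1 (k - j)%N `&`
    \bigcap_(l in [set` i :: J']) (Y l @^-1` A' j l))).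
  by rewrite -termE setIC.
rewrite IH; last 2 first.
- by rewrite -cat1s uniq_catCA.
- by move=> l lJ1; apply: sJ; rewrite inE lJ1 orbT.
rewrite big_cons /A' eqxx lawY // big_seq.
under eq_bigr => l lJ'.
  have -> : (l == i) = false by apply: contraNF iJ' => /eqP <-.
  over.
by rewrite -big_seq prodE -!EFinM; congr EFin; ring.
Qed.

End SumsOfIndependentVariables.

(** * Equivalence of the three properties *)

Section Constructions.
Context {R : realType}.
Implicit Types (mu nu : probability nat R) (p : nat -> R).
Local Notation U := (measurableTypeR R).
Local Notation P := (unit_lebesgue : probability U R).

Lemma series_poisson (lambda : R) : 0 < lambda ->
  series (poisson_pmf lambda) @ \oo --> (1 : R).
Proof.
move=> l0; have := @series_pmass _ (poisson_prob lambda 0%N : probability nat R).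
rewrite (_ : pmass _ = poisson_pmf lambda) //; apply/funext => k.
by rewrite /pmass /= /poisson_prob l0 esum_set1 // lee_fin poisson_pmf_ge0.
Qed.

(** Any finite set of indices is completed to an initial segment with trivial
    events. *)
Lemma mutually_independent_initial d (T : measurableType d) (Q : probability T R)
    (Y : nat -> {RV Q >-> nat}) :
  (forall n (A : nat -> set nat), Q (\bigcap_(i in `I_n) (Y i @^-1` A i)) =
     (\prod_(i < n) Q (Y i @^-1` A i))%E) ->
  mutually_independent Y.
Proof.
move=> indY J A uJ _; pose n := (\max_(i <- J) i).+1.
have Jn i : i \in J -> (i < n)%N.
  by move=> iJ; rewrite /n ltnS; exact: leq_bigmax_seq.
pose A' i := if i \in J then A i else setT.
have -> : \bigcap_(i in [set` J]) (Y i @^-1` A i) =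
    \bigcap_(i in `I_n) (Y i @^-1` A' i).
  apply/seteqP; split=> w h i /=.
    by move=> _; rewrite /A'; case: ifPn => // iJ; exact: h.
  by move=> iJ; have := h i (Jn i iJ); rewrite /A' iJ.
rewrite indY -(big_mkord xpredT (fun i => Q (Y i @^-1` A' i))).
rewrite (bigID (fun i => i \in J)) /= [X in (_ * X)%E]big1 ?mule1; last first.
  by move=> i /negbTE iJ; rewrite /A' iJ preimage_setT probability_setT.
rewrite -big_filter (perm_big J).
  by rewrite !big_seq; apply: eq_bigr => i iJ; rewrite /A' iJ.
apply: uniq_perm => //; first by rewrite filter_uniq ?iota_uniq.
move=> i; rewrite mem_filter mem_index_iota leq0n /=.
by case: (boolP (i \in J)) => [/Jn ->|].
Qed.

(** The first digit, read with Poisson cells, is [N]; the [Y i] are the digits of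
    the shifted point, read with cells of lengths [p].  Everything generated by the
    [Y i] is a preimage under the first shift, hence independent of [N]. *)
Lemma poisson_data_exists (lambda : R) p : 0 < lambda ->
  (forall k, 0 <= p k) -> series p @ \oo --> (1 : R) ->
  exists (N : {RV P >-> nat}) (Y : nat -> {RV P >-> nat}),
  [/\ forall k, P (N @^-1` [set k]) = (poisson_pmf lambda k)%:E,
      mutually_independent Y /\ identically_distributed Y,
      independent_of_family N Y &
      forall i k, P (Y i @^-1` [set k]) = (p k)%:E].
Proof.
move=> l0 p0 p1.
have [dN [sN spN]] := splits_off_exists (poisson_pmf_ge0 lambda) (series_poisson l0).
have [dY [sY spY]] := splits_off_exists p0 p1.
have mN k : measurable (dN @^-1` [set k]) by exact: (measurable_dig spN).
have mY i k : measurable ((digit dY sY i \o sN) @^-1` [set k]).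
  rewrite comp_preimage; apply: (measurable_shift spN).
  exact: (measurable_digit spY).
pose N : {RV P >-> nat} := nat_rv mN.
pose Y i : {RV P >-> nat} := nat_rv (mY i).
have lawY i (A : set nat) : P (Y i @^-1` A) = P (dY @^-1` A).
  transitivity (P (sN @^-1` (digit dY sY i @^-1` A))); first by [].
  rewrite (shift_preserves spN) ?(digit_law spY) //; exact: (measurable_digit spY).
exists N, Y; split.
- exact: (splits_off_law spN).
- split; last by move=> i j A _; rewrite !lawY.
  apply: mutually_independent_initial => n A.
  transitivity (P (sN @^-1` (\bigcap_(i in `I_n) (digit dY sY i @^-1` A i)))).
    by [].
  rewrite (shift_preserves spN); last exact: (measurable_digits spY).
  by rewrite (digits_independent spY); apply: eq_bigr => i _; rewrite lawY.
- move=> B E _ sE; have [C mC <-] : preimage_set_system setT sN measurable E.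
    apply: sE; split.
      by apply: sigma_algebra_preimage; exact: sigma_algebra_measurable.
    move=> _ [i [A _ ->]]; exists (digit dY sY i @^-1` A); last by rewrite setTI.
    exact: (measurable_digit spY).
  rewrite setTI (shift_preserves spN mC); exact: (splits_off_indep spN).
- by move=> i k; rewrite lawY (splits_off_law spY).
Qed.

(** The law of a sum of [n] independent variables with law [nu]; the intensity [1]
    in the construction of these variables is arbitrary. *)
Lemma convolution_power_exists nu n : exists rho : probability nat R,
  pmass rho =1 cpow (pmass nu) n.
Proof.
have [_ [Y [_ [indY _] _ lawY]]] :=
  poisson_data_exists ltr01 (pmass_ge0 nu) (@series_pmass _ nu).
have law := law_of_sum indY (iota_uniq 0 n) (fun i k _ => lawY i k).
pose S : {RV P >-> nat} := nat_rv (fun m => (law m).1).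
exists (distribution P S) => m.
by have := congr1 fine (law m).2; rewrite size_iota.
Qed.

Lemma sum_iota (F : nat -> nat) n : (\sum_(i <- iota 0 n) F i = \sum_(i < n) F i)%N.
Proof. by rewrite -(big_mkord xpredT F) /index_iota subn0. Qed.

Lemma generated_sum d (T : measurableType d) (Q : probability T R)
    (Y : nat -> {RV Q >-> nat}) n m :
  generated_by Y [set w | \sum_(i < n) Y i w = m]%N.
Proof.
pose G :=
  [set E | exists i : nat, exists2 A : set nat, measurable A & E = Y i @^-1` A].
apply: (@sum_fibers_measurable _ (g_sigma_algebraType G) Y) => i k.
by apply: sub_sigma_algebra; exists i, [set k].
Qed.

Lemma compound_sum_measurable d (T : measurableType d)
    (N : T -> nat) (Y : nat -> T -> nat) :
  (forall k, measurable (N @^-1` [set k])) ->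
  (forall i k, measurable (Y i @^-1` [set k])) ->
  forall m, measurable ((fun w => \sum_(i < N w) Y i w)%N @^-1` [set m]).
Proof.
move=> mN mY m; rewrite (_ : _ @^-1` _ = \bigcup_n (N @^-1` [set n] `&`
    [set w | \sum_(i < n) Y i w = m]%N)).
  apply: bigcup_measurable => n _; apply: measurableI => //.
  exact: sum_fibers_measurable.
by apply/seteqP; split=> w /= => [e|[n _ [/= -> //]]]; exists (N w).
Qed.

(** Split according to the value [n] of [N], which is independent of the sum of the
    first [n] summands. *)
Lemma compound_mass d (T : measurableType d) (Q : probability T R)
    (lambda : R) (N : {RV Q >-> nat}) (Y : nat -> {RV Q >-> nat}) p mu :
  (forall k, Q (N @^-1` [set k]) = (poisson_pmf lambda k)%:E) ->
  mutually_independent Y -> independent_of_family N Y ->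
  (forall i k, Q (Y i @^-1` [set k]) = (p k)%:E) ->
  (forall A, Q [set w | A (\sum_(i < N w) Y i w)%N] = mu A) ->
  forall m, series (fun n => poisson_pmf lambda n * cpow p n m) @ \oo --> pmass mu m.
Proof.
move=> lawN indY indNY lawY lawS m.
have mN k : measurable (N @^-1` [set k]) by exact: measurable_rv.
have mY i k : measurable (Y i @^-1` [set k]) by exact: measurable_rv.
rewrite /pmass -lawS.
have := @series_partition _ _ _ Q _ _ mN (compound_sum_measurable mN mY m).
rewrite (_ : (fun k => fine _) = fun n => poisson_pmf lambda n * cpow p n m) //.
apply/funext => n.
rewrite (_ : _ `&` _ = N @^-1` [set n] `&` [set w | \sum_(i < n) Y i w = m]%N).
  rewrite indNY //; last exact: generated_sum.
  rewrite lawN (_ : [set w | _] = [set w | \sum_(i <- iota 0 n) Y i w = m]%N).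
    have law := law_of_sum indY (iota_uniq 0 n) (fun i k _ => lawY i k).
    by rewrite (law m).2 size_iota.
  by apply/seteqP; split=> w /=; rewrite (sum_iota (fun i => Y i w)).
by apply/seteqP; split=> w /= [-> ].
Qed.

Lemma poisson_compound_exists (lambda : R) p : 0 < lambda ->
  (forall k, 0 <= p k) -> series p @ \oo --> (1 : R) ->
  exists2 nu : probability nat R, poisson_compound nu &
    log_derivative (jump_rates lambda p) (pmass nu).
Proof.
move=> l0 p0 p1; have [N [Y [lawN iidY indNY lawY]]] := poisson_data_exists l0 p0 p1.
have mN k : measurable (N @^-1` [set k]) by exact: measurable_rv.
have mY i k : measurable (Y i @^-1` [set k]) by exact: measurable_rv.
pose S : {RV P >-> nat} := nat_rv (compound_sum_measurable mN mY).
exists (distribution P S).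
  by exists _, U, P, lambda, N, Y; split.
apply: compound_log_derivative => //.
by apply: compound_mass lawN _ indNY lawY _ => //; case: iidY.
Qed.

Lemma poisson_compound_log_derivative mu : poisson_compound mu ->
  exists lambda, exists p : nat -> R, [/\ 0 < lambda, forall k, 0 <= p k,
    series p @ \oo --> (1 : R) & log_derivative (jump_rates lambda p) (pmass mu)].
Proof.
move=> [d [T [Q [lambda [N [Y [l0 lawN [indY idY] indNY lawS]]]]]]].
pose nu : probability nat R := distribution Q (Y 0%N).
exists lambda, (pmass nu); split=> //; first exact: pmass_ge0.
  exact: series_pmass.
apply: compound_log_derivative => //; apply: compound_mass lawN indY indNY _ lawS.
by move=> i k; rewrite (idY i 0%N) // -pmassE.
Qed.

(** Dividing the intensity by [n] divides the logarithmic derivative by [n], and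
    taking the [n]-fold convolution multiplies it by [n].  Conversely, the compound
    built from the logarithmic derivative of [mu] has the law [mu]. *)
Lemma poisson_compoundP mu : poisson_compound mu <-> has_convolution_roots mu.
Proof.
split=> [/poisson_compound_log_derivative|/convolution_roots_jump_rates].
  move=> [lambda [p [l0 p0 p1 Lmu]]] n n0.
  have n0R : 0 < n%:R :> R by rewrite ltr0n.
  have [nu _ Lnu] := poisson_compound_exists (divr_gt0 l0 n0R) p0 p1.
  have [rho rhoE] := convolution_power_exists nu n.
  exists nu => m; rewrite -rhoE; move: m.
  apply: (log_derivative_law_unique Lmu).
  rewrite (_ : pmass rho = cpow (pmass nu) n); last exact/funext.
  rewrite (_ : jump_rates lambda p = fun j => jump_rates (lambda / n%:R) p j *+ n).
    exact: log_derivative_cpow.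
  apply/funext => j; rewrite /jump_rates -[RHS]mulr_natr; field.
  by rewrite gt_eqF.
move=> [lambda [p [l0 p0 p1 Lmu]]].
have [nu + Lnu] := poisson_compound_exists l0 p0 p1.
move=> [d [T [Q [l [N [Y [h1 h2 h3 h4 lawS]]]]]]].
exists d, T, Q, l, N, Y; split=> // A; rewrite lawS.
exact: probability_nat_ext (log_derivative_law_unique Lnu Lmu) A.
Qed.

(** The convolution power of a root is realised as a law, so that the uniqueness
    theorem for generating functions applies to it. *)
Lemma pgf_rootsP mu : pgf_has_all_roots mu <-> has_convolution_roots mu.
Proof.
split=> roots n n0; have [nu e] := roots n n0; exists nu; last exact: pgf_cpow.
have [rho rhoE] := convolution_power_exists nu n.
move=> m; rewrite -rhoE; move: m; apply: pgf_inj => s s1.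
by rewrite e // (pgf_cpow rhoE).
Qed.

Lemma measure_ae_eq d (T : measurableType d) (Q : probability T R) (E F : set T) :
  measurable E -> measurable F -> {ae Q, forall w, E w <-> F w} -> Q E = Q F.
Proof.
move=> mE mF [M [mM M0 sM]]; suff half A B : measurable A -> measurable B ->
    (forall w, ~ M w -> A w -> B w) -> (Q A <= Q B)%E.
  apply/eqP; rewrite eq_le; apply/andP; split; apply: half => // w nM;
    have [h1 h2] : E w <-> F w by apply: contrapT => nEF; exact: nM (sM _ nEF).
    exact: h1.
  exact: h2.
move=> mA mB AB; rewrite -[leRHS]adde0 -M0.
apply: (@le_trans _ _ (Q (B `|` M))); last exact: measureU2.
apply: le_measure; rewrite ?inE //; first exact: measurableU.
by move=> w Aw; have [Mw|nMw] := pselect (M w); [right|left; exact: AB].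
Qed.

(** A real component that is almost surely an integer is replaced by the value of a
    measurable function of it with values in [nat], which preserves independence
    and the common law; almost surely, the sum is unchanged. *)
Lemma integer_components_convolution_roots mu :
  has_integer_components (real_law mu) -> has_convolution_roots mu.
Proof.
move=> ic n n0; have [d [T [Q [X [[indX idX lawX] intX]]]]] := ic n n0.
have mB k : measurable ([set k%:R : R] : set R) by exact: measurable_set1.
have tB : trivIset setT (fun k : nat => [set k%:R : R]).
  by move=> i j _ _ [x [/= -> /eqP]]; rewrite eqr_nat => /eqP.
have [g [mg gE]] := selector_exists mB tB.
have gnat k : g k%:R = k by exact: gE.
have mgA (A : set nat) : measurable (g @^-1` A).
  by rewrite -[X in measurable X]setTI; exact: (measurable_fun_fibers mg).
have mY i k : measurable ((g \o X i) @^-1` [set k]).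
  by rewrite comp_preimage; exact: measurable_rv.
pose Y i : {RV Q >-> nat} := nat_rv (mY i).
have indY : mutually_independent Y.
  by move=> J A uJ _; exact: (indX J (fun i => g @^-1` A i) uJ).
pose i0 := Ordinal n0; pose nu : probability nat R := distribution Q (Y i0).
exists nu => m.
have lawY i k : i \in index_enum 'I_n -> Q (Y i @^-1` [set k]) = (pmass nu k)%:E.
  by move=> _; rewrite -pmassE; exact: (idX i i0 (g @^-1` [set k])).
have [mS lawS] := law_of_sum indY (index_enum_uniq 'I_n) lawY m.
have -> : pmass mu m = fine (Q [set w | \sum_(i < n) X i w = m%:R]).
  rewrite (lawX [set m%:R]) ?/real_law //; congr (fine (mu _)).
  apply/seteqP; split=> k /=; first by move=> ->.
  by rewrite /natR => /eqP; rewrite eqr_nat => /eqP.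
have mX : measurable [set w | \sum_(i < n) X i w = m%:R].
  have h : measurable_fun setT (fun w => \sum_(i < n) X i w).
    by apply: measurable_sum => i; exact: measurable_funPT.
  by have := h measurableT _ (mB m); rewrite setTI.
have allint : {ae Q, forall w, forall i, exists k : nat, X i w = k%:R}.
  have : {ae Q, forall w, forall i, i \in enum 'I_n -> exists k : nat, X i w = k%:R}.
    elim: (enum _) => [|i s IH]; first exact: nearW.
    have := intX i; move: IH; apply: filterS2 => w hs hi j.
    by rewrite inE => /orP[/eqP ->|/hs].
  by apply: filterS => w h i; apply: h; rewrite mem_enum.
rewrite (@measure_ae_eq _ _ Q _
  [set w | \sum_(i <- index_enum 'I_n) Y i w = m]%N) //.
  by rewrite lawS /= /index_enum -enumT size_enum_ord.
apply: filterS allint => w h /=.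
have -> : \sum_(i < n) X i w = (\sum_(i < n) Y i w)%N%:R.
  rewrite natr_sum; apply: eq_bigr => i _; have [k e] := h i.
  by rewrite /Y /= e gnat.
by split=> [/eqP|->//]; rewrite eqr_nat => /eqP.
Qed.

(** Independent variables with the law of the root, viewed as real variables, are
    integer-valued components. *)
Lemma convolution_roots_components mu : has_convolution_roots mu ->
  infinitely_divisible (real_law mu) /\ has_integer_components (real_law mu).
Proof.
move=> roots; suff comps n : (0 < n)%N -> exists X : 'I_n -> {RV P >-> R},
    is_components (real_law mu) X /\ forall i w, exists k : nat, X i w = k%:R.
  split=> n /comps [X [cX iX]]; exists _, U, P, X; first exact: cX.
  by split=> // i; apply: aeW => w; exact: iX.
move=> /roots [nu nuE].
have [_ [Y [_ [indY idY] _ lawY]]] :=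
  poisson_data_exists ltr01 (pmass_ge0 nu) (@series_pmass _ nu).
have mX (i : 'I_n) : measurable_fun setT (@natR R \o Y i).
  by apply: measurableT_comp => //; exact: measurable_funPT.
pose X (i : 'I_n) : {RV P >-> R} := HB.pack_for {mfun U >-> R} (@natR R \o Y i)
  (isMeasurableFun.Build _ _ U R (@natR R \o Y i) (mX i)).
exists X; split; last by move=> i w; exists (Y i w).
split.
- move=> J A uJ mA.
  (* Events indexed by ordinals are extended by trivial ones to all of [nat]. *)
  pose A' k := if insub k is Some i then @natR R @^-1` A i else setT.
  have A'E (i : 'I_n) : A' i = @natR R @^-1` A i by rewrite /A' valK.
  have := indY (map val J) A' _ (fun=> I); rewrite map_inj_uniq; last exact: val_inj.
  rewrite big_map => /(_ uJ) indJ.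
  have -> : \bigcap_(i in [set` J]) (X i @^-1` A i) =
      \bigcap_(i in [set` map val J]) (Y i @^-1` A' i).
    apply/seteqP; split=> w h i /=.
      by move=> /mapP[j jJ ->]; rewrite /= A'E; exact: h.
    by move=> iJ; have := h (val i); rewrite /= A'E; apply; exact: map_f.
  by rewrite indJ; apply: eq_bigr => i _; rewrite A'E.
- by move=> i j A _; exact: (idY i j (@natR R @^-1` A)).
- move=> A mA.
  have law := law_of_sum indY (iota_uniq 0 n) (fun i k _ => lawY i k).
  pose S : {RV P >-> nat} := nat_rv (fun m => (law m).1).
  rewrite (_ : [set w | _] = S @^-1` (@natR R @^-1` A)).
    apply: (@probability_nat_ext _ (distribution P S) mu) => m.
    by have := congr1 fine (law m).2; rewrite size_iota nuE.
  have SE w : \sum_(i < n) X i w = natR R (S w).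
    by rewrite /natR /= (sum_iota (fun i => Y i w)) natr_sum.
  by apply/seteqP; split=> w; rewrite /= SE.
Qed.

End Constructions.

Theorem theorem7 (R : realType) (mu : probability nat R) :
  [/\ infinitely_divisible (real_law mu) /\ has_integer_components (real_law mu) <->
        pgf_has_all_roots mu,
      infinitely_divisible (real_law mu) /\ has_integer_components (real_law mu) ->
        poisson_compound mu &
      poisson_compound mu ->
        infinitely_divisible (real_law mu) /\ has_integer_components (real_law mu)].
Proof.
have compsP : infinitely_divisible (real_law mu) /\
    has_integer_components (real_law mu) <-> has_convolution_roots mu.
  split; last exact: convolution_roots_components.
  by move=> [_]; exact: integer_components_convolution_roots.
by split; rewrite compsP ?pgf_rootsP // poisson_compoundP.
Qed.
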